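(* Let $d_1\le d_2$ be positive integers, let $\rho$ be a density matrix on $\mathbb{C}^{d_1}\otimes\mathbb{C}^{d_2}$ with correlation matrix $T$, and let $k\ge 1$ be an integer. If the Schmidt number of $\rho$ satisfies $\mathrm{SN}(\rho)\le k$, then $$\|T\|_{\mathrm{Tr}}\le \sqrt{(d_1-1)(d_2-1)}+\sqrt{d_1d_2}\,(k-1).$$
   Context: Local operator bases: $\{\lambda_i\}_{i=0}^{d_1^2-1}$ is a basis of the complex $d_1\times d_1$ matrices with $\lambda_0=\mathbb{1}$ and $\mathrm{Tr}(\lambda_i\lambda_j^\dagger)=d_1\delta_{ij}$; $\{\tilde\lambda_j\}_{j=0}^{d_2^2-1}$ is a basis of the complex $d_2\times d_2$ matrices with $\tilde\lambda_0=\mathbb{1}$ and $\mathrm{Tr}(\tilde\lambda_i\tilde\lambda_j^\dagger)=d_2\delta_{ij}$. The bases are otherwise arbitrary (not necessarily Hermitian). Bloch decomposition: every density matrix $\rho$ on $\mathbb{C}^{d_1}\otimes\mathbb{C}^{d_2}$ is uniquely written as $$\rho=\frac1{d_1d_2}\Big[\mathbb{1}\otimes\mathbb{1}+\sum_{i=1}^{d_1^2-1}\alpha_i\lambda_i\otimes\mathbb{1}+\sum_{j=1}^{d_2^2-1}\beta_j\,\mathbb{1}\otimes\tilde\lambda_j+\sum_{i=1}^{d_1^2-1}\sum_{j=1}^{d_2^2-1}T_{ij}\,\lambda_i\otimes\tilde\lambda_j\Big].$$ The $(d_1^2-1)\times(d_2^2-1)$ matrix $T=(T_{ij})$ is the correlation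 matrix of $\rho$. $\|\cdot\|_{\mathrm{Tr}}$ denotes the trace norm, i.e. the sum of the singular values. Schmidt number: the Schmidt rank $\mathrm{SR}(|\psi\rangle)$ of a unit vector $|\psi\rangle\in\mathbb{C}^{d_1}\otimes\mathbb{C}^{d_2}$ is the number of nonzero coefficients in its Schmidt decomposition. For a density matrix, $\mathrm{SN}(\rho)$ is the smallest $r$ such that $\rho=\sum_i p_i|\psi_i\rangle\langle\psi_i|$ for some finite probability distribution $(p_i)$ and unit vectors $|\psi_i\rangle$ with $\mathrm{SR}(|\psi_i\rangle)\le r$ for all $i$. *)

(* Defs.v *)
From mathcomp Require Import all_boot all_order all_algebra.
From mathcomp Require Import reals.
From mathcomp Require Export complex.
From mathcomp Require mxtens.

Set Implicit Arguments.
Unset Strict Implicit.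
Unset Printing Implicit Defensive.

Import GRing.Theory Num.Theory.
Local Open Scope ring_scope.
Local Open Scope sesquilinear_scope.

(* [C] is instantiated to [R[i]] with [R : realType] in the theorem. Real
   quantities are elements of [C]: in its order, [0 <= x] entails that [x] is
   real. Kets are column vectors, and [M ^t* ] is the conjugate transpose. *)

Notation "A ⊗ B" := (mxtens.tensmx A B)
  (at level 40, left associativity) : ring_scope.

(* Here [C^d1 ⊗ C^d2] is ['cV[C]_(d1 * d2)]. The product of two kets has
   [1 * 1] columns, which is convertible to [1]. *)
Definition tensket (C : numClosedFieldType) (d1 d2 : nat)
  (u : 'cV[C]_d1) (v : 'cV[C]_d2) : 'cV[C]_(d1 * d2) := u ⊗ v.

Definition ketbra (C : numClosedFieldType) (n : nat) (psi : 'cV[C]_n) :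
  'M[C]_n := psi *m psi ^t*.

Definition orthonormal_kets (C : numClosedFieldType) (n d : nat)
  (u : 'I_n -> 'cV[C]_d) : Prop :=
  forall i j, ((u i) ^t* *m u j) 0 0 = (i == j)%:R.

Definition unit_ket (C : numClosedFieldType) (d : nat) (psi : 'cV[C]_d) : Prop :=
  (psi ^t* *m psi) 0 0 = 1.

Definition density_matrix (C : numClosedFieldType) (n : nat) (rho : 'M[C]_n) :
  Prop :=
  [/\ rho \is hermsymmx,
      forall v : 'cV[C]_n, 0 <= (v ^t* *m rho *m v) 0 0
    & \tr rho = 1].

(* For [0 < d], the index type has [d ^ 2] elements. It is written as a
   successor so that [ord0] is the index of the identity matrix and the
   remaining indices are [lift ord0 i] with [i : 'I_(d ^ 2).-1]. *)
Definition local_basis (C : numClosedFieldType) (d : nat)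
  (lam : 'I_(d ^ 2).-1.+1 -> 'M[C]_d) : Prop :=
  [/\ basis_of {: 'M[C]_d} [seq lam i | i <- enum 'I_(d ^ 2).-1.+1],
      lam ord0 = 1%:M
    & forall i j, \tr (lam i *m (lam j) ^t*) = d%:R * (i == j)%:R].

Definition bloch_decomposition (C : numClosedFieldType) (d1 d2 : nat)
  (lam1 : 'I_(d1 ^ 2).-1.+1 -> 'M[C]_d1) (lam2 : 'I_(d2 ^ 2).-1.+1 -> 'M[C]_d2)
  (rho : 'M[C]_(d1 * d2)) (alpha : 'I_(d1 ^ 2).-1 -> C)
  (beta : 'I_(d2 ^ 2).-1 -> C) (T : 'M[C]_((d1 ^ 2).-1, (d2 ^ 2).-1)) : Prop :=
  rho = (d1%:R * d2%:R)^-1 *: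
    ((1%:M : 'M[C]_d1) ⊗ (1%:M : 'M[C]_d2)
     + \sum_i alpha i *: (lam1 (lift ord0 i) ⊗ (1%:M : 'M[C]_d2))
     + \sum_j beta j *: ((1%:M : 'M[C]_d1) ⊗ lam2 (lift ord0 j))
     + \sum_i \sum_j
         T i j *: (lam1 (lift ord0 i) ⊗ lam2 (lift ord0 j))).

Definition correlation_matrix (C : numClosedFieldType) (d1 d2 : nat)
  (lam1 : 'I_(d1 ^ 2).-1.+1 -> 'M[C]_d1) (lam2 : 'I_(d2 ^ 2).-1.+1 -> 'M[C]_d2)
  (rho : 'M[C]_(d1 * d2)) (T : 'M[C]_((d1 ^ 2).-1, (d2 ^ 2).-1)) : Prop :=
  exists alpha beta, bloch_decomposition lam1 lam2 rho alpha beta T.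

(* The square roots of the eigenvalues of [A ^t* *m A], with multiplicity.
   When [m < n] the list contains additional zeros. *)
Definition singular_value (C : numClosedFieldType) (m n : nat)
  (A : 'M[C]_(m, n)) (i : 'I_n) : C :=
  sqrtC (spectral_diag (A ^t* *m A) 0 i).

Definition trace_norm (C : numClosedFieldType) (m n : nat)
  (A : 'M[C]_(m, n)) : C := \sum_i singular_value A i.

Definition schmidt_decomposition (C : numClosedFieldType) (d1 d2 : nat)
  (psi : 'cV[C]_(d1 * d2)) (s : 'I_(minn d1 d2) -> C)
  (u : 'I_(minn d1 d2) -> 'cV[C]_d1) (v : 'I_(minn d1 d2) -> 'cV[C]_d2) : Prop :=
  [/\ orthonormal_kets u, orthonormal_kets v, forall i, 0 <= s i
    & psi = \sum_i s i *: tensket (u i) (v i)].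

(* [schmidt_rank psi r] reads SR(psi) = r. *)
Definition schmidt_rank (C : numClosedFieldType) (d1 d2 : nat)
  (psi : 'cV[C]_(d1 * d2)) (r : nat) : Prop :=
  exists s u v, schmidt_decomposition psi s u v /\ #|[set i | s i != 0]| = r.

Definition schmidt_mixture (C : numClosedFieldType) (d1 d2 : nat)
  (rho : 'M[C]_(d1 * d2)) (r : nat) : Prop :=
  exists (n : nat) (p : 'I_n -> C) (psi : 'I_n -> 'cV[C]_(d1 * d2)),
    [/\ forall i, 0 <= p i,
        \sum_i p i = 1,
        forall i, unit_ket (psi i),
        forall i, exists2 q : nat, schmidt_rank (psi i) q & (q <= r)%N
      & rho = \sum_i p i *: ketbra (psi i)].

(* [schmidt_number rho r] reads SN(rho) = r. *)
Definition schmidt_number (C : numClosedFieldType) (d1 d2 : nat)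
  (rho : 'M[C]_(d1 * d2)) (r : nat) : Prop :=
  schmidt_mixture rho r /\ forall q : nat, schmidt_mixture rho q -> (r <= q)%N.

(* Main.v *)
(* Writing T_ij = tr(rho (lam_i^dagger ⊗ lam'_j^dagger)) makes T linear in rho,
   so by convexity rho may be taken pure, psi = sum_a s_a u_a ⊗ v_a. Then
   T = sum_ab s_a s_b x_ab y_ab^T with x_ab, y_ab the Bloch vectors of u_a u_b^*
   and v_a v_b^*, whose squared norms are d1 - delta_ab and d2 - delta_ab by
   Parseval. As the trace norm of a rank-one matrix x y^T is |x| |y|, the trace
   norm of T is at most sqrt((d1-1)(d2-1)) + sqrt(d1 d2) ((sum_a s_a)^2 - 1),
   and (sum_a s_a)^2 is at most the Schmidt rank. The triangle inequality for
   the trace norm is obtained from its dual form tr(W T), W a contraction. *)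
Require Import Defs.
From mathcomp Require Import all_boot all_order all_algebra.
From mathcomp Require Import reals mxtens.

Import Order.TTheory GRing.Theory Num.Theory.
Local Open Scope ring_scope.
Local Open Scope sesquilinear_scope.

Set Implicit Arguments.
Unset Strict Implicit.

Section NumClosed.
Variable C : numClosedFieldType.

(** * Conjugate transposes, Gram matrices and Cauchy-Schwarz *)

Lemma trmxC_mul m n p (A : 'M[C]_(m, n)) (B : 'M[C]_(n, p)) :
  (A *m B) ^t* = B ^t* *m A ^t*.
Proof. by rewrite trmx_mul map_mxM. Qed.

Lemma gramE m n (A : 'M[C]_(m, n)) i :
  (A ^t* *m A) i i = \sum_j `|A j i| ^+ 2.
Proof. by rewrite mxE; apply: eq_bigr => j _; rewrite !mxE normCKC. Qed.

Lemma gram_ge0 m n (A : 'M[C]_(m, n)) i : 0 <= (A ^t* *m A) i i.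
Proof. by rewrite gramE sumr_ge0 // => j _; rewrite exprn_ge0. Qed.

Lemma CauchySchwarz_col m (x y : 'cV[C]_m) :
  `|(y ^t* *m x) 0 0| <=
    sqrtC ((y ^t* *m y) 0 0) * sqrtC ((x ^t* *m x) 0 0).
Proof.
have : `|dotmx (y ^t*) (x ^t*)| <=
    sqrtC (dotmx (y ^t*) (y ^t*)) * sqrtC (dotmx (x ^t*) (x ^t*)).
  by have [] := CauchySchwarz_sqrt (@dotmx C m) (y ^t*) (x ^t*).
by rewrite !dotmxE !trmxCK.
Qed.

(** * Contractions and the dual form of the trace norm *)

Definition contraction m n (W : 'M[C]_(n, m)) : Prop :=
  forall x : 'cV[C]_m, ((W *m x) ^t* *m (W *m x)) 0 0 <= (x ^t* *m x) 0 0.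

(** By the spectral theorem, [A] sends an orthonormal eigenbasis of the normal matrix [A ^t* *m A]
    to orthogonal vectors whose squared lengths are the eigenvalues. *)
Lemma gram_spectral m n (A : 'M[C]_(m, n)) :
  let B := A *m (spectralmx (A ^t* *m A)) ^t* in
  B ^t* *m B = diag_mx (spectral_diag (A ^t* *m A)).
Proof.
set P := spectralmx _; set D := spectral_diag _ => B.
have Pu : P \is unitarymx by apply: spectral_unitarymx.
have PP : P *m P ^t* = 1%:M by apply/unitarymxP.
have An : A ^t* *m A \is normalmx.
  by apply/normalmxP; rewrite trmxC_mul trmxCK.
rewrite /B trmxC_mul trmxCK !mulmxA -(mulmxA P) [A ^t* *m A](orthomx_spectralP An).
by rewrite -/P -/D invmx_unitary // !mulmxA PP mul1mx -mulmxA PP mulmx1.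
Qed.

Lemma gram_spectral_ge0 m n (A : 'M[C]_(m, n)) i :
  0 <= spectral_diag (A ^t* *m A) 0 i.
Proof.
have := gram_ge0 (A *m (spectralmx (A ^t* *m A)) ^t*) i.
by rewrite gram_spectral mxE eqxx mulr1n.
Qed.

Lemma trace_norm_ge0 m n (A : 'M[C]_(m, n)) : 0 <= trace_norm A.
Proof.
by apply: sumr_ge0 => i _; rewrite sqrtC_ge0 gram_spectral_ge0.
Qed.

(** The witness is the adjoint of the partial isometry in the polar decomposition of [A]. *)
Lemma trace_norm_dual m n (A : 'M[C]_(m, n)) :
  exists2 W : 'M[C]_(n, m), contraction W & trace_norm A = \tr (W *m A).
Proof.
set P := spectralmx (A ^t* *m A); set D := spectral_diag (A ^t* *m A).
have PP : P *m P ^t* = 1%:M by apply/unitarymxP/spectral_unitarymx.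
pose B := A *m P ^t*; have BB : B ^t* *m B = diag_mx D by apply: gram_spectral.
pose dl : 'rV[C]_n := \row_i (sqrtC (D 0 i))^-1.
have dlC : (diag_mx dl) ^t* = diag_mx dl.
  rewrite tr_diag_mx map_diag_mx; congr diag_mx; apply/rowP => i; rewrite !mxE.
  by apply: conj_Creal; rewrite rpredV sqrtC_real ?gram_spectral_ge0.
(* A = V *m diag (singular values) *m P, with V a partial isometry: the zero
   singular values give zero columns, since [0^-1 = 0]. *)
pose V := B *m diag_mx dl.
have VB : V ^t* *m B = diag_mx (\row_i sqrtC (D 0 i)).
  rewrite /V trmxC_mul dlC -mulmxA BB mulmx_diag; congr diag_mx; apply/rowP => i.
  rewrite !mxE; have [->|nz] := eqVneq (D 0 i) 0; first by rewrite sqrtC0 mulr0.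
  by rewrite -{2}[D 0 i]sqrtCK expr2 mulKf // sqrtC_eq0.
(* [V ^t* *m V] is diagonal, with entry 1 at the nonzero singular values and 0 at the others, where
   the column of [V] vanishes; so [V] is a partial isometry. *)
have VVV : V *m (V ^t* *m V) = V.
  rewrite [X in _ *m X]mulmxA VB /V -!mulmxA !mulmx_diag; congr (_ *m (_ *m diag_mx _)).
  apply/rowP => i.
  rewrite !mxE; have [->|nz] := eqVneq (D 0 i) 0; first by rewrite sqrtC0 invr0 mul0r.
  by rewrite mulfV ?mulr1 // sqrtC_eq0.
clearbody V; exists (P ^t* *m V ^t*); last first.
  rewrite -mulmxA mxtrace_mulC -mulmxA -/B VB mxtrace_diag.
  by apply: eq_bigr => i _; rewrite mxE.
move=> x; rewrite -subr_ge0.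
(* Bessel: [V *m V ^t*] is an orthogonal projection. *)
suff -> : (x ^t* *m x) 0 0 - ((P ^t* *m V ^t* *m x) ^t* *m (P ^t* *m V ^t* *m x)) 0 0
   = ((x - V *m V ^t* *m x) ^t* *m (x - V *m V ^t* *m x)) 0 0 by apply: gram_ge0.
have -> : (P ^t* *m V ^t* *m x) ^t* *m (P ^t* *m V ^t* *m x) = x ^t* *m V *m V ^t* *m x.
  by rewrite !trmxC_mul !trmxCK !mulmxA -(mulmxA _ P) PP mulmx1.
rewrite [(x - _) ^T]raddfB /= [(_ - _) ^ _]raddfB /= !trmxC_mul !trmxCK.
rewrite mulmxBl !mulmxBr !mulmxA.
have -> : x ^t* *m V *m V ^t* *m V *m V ^t* *m x = x ^t* *m V *m V ^t* *m x.
  by have := congr1 (fun X => x ^t* *m X *m V ^t* *m x) VVV; rewrite !mulmxA.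
by rewrite subrr subr0 !mxE.
Qed.

(** By cyclicity the trace is the inner product of the conjugate of [y] with [W *m x], to which
    Cauchy-Schwarz applies. *)
Lemma contraction_rank1 m n (W : 'M[C]_(n, m)) (x : 'cV[C]_m) (y : 'cV[C]_n) :
  contraction W ->
  `|\tr (W *m (x *m y^T))| <=
    sqrtC (\sum_i `|x i 0| ^+ 2) * sqrtC (\sum_j `|y j 0| ^+ 2).
Proof.
move=> hW; pose z := map_mx Num.conj y.
have zC : z ^t* = y^T by apply/matrixP => i j; rewrite !mxE conjCK.
rewrite mulmxA mxtrace_mulC /mxtrace big_ord1 -zC.
apply: le_trans (CauchySchwarz_col _ _) _.
rewrite mulrC; have -> : (z ^t* *m z) 0 0 = \sum_j `|y j 0| ^+ 2.
  by rewrite gramE; apply: eq_bigr => j _; rewrite mxE norm_conjC.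
rewrite ler_wpM2r ?sqrtC_ge0 ?sumr_ge0 // => [j _|]; first by rewrite exprn_ge0.
by rewrite ler_sqrtC ?nnegrE ?gram_ge0 -?gramE ?gram_ge0.
Qed.

Lemma sqr_sum_le_card n (s : 'I_n -> C) :
  (forall i, 0 <= s i) ->
  (\sum_i s i) ^+ 2 <= #|[set i | s i != 0]|%:R * \sum_i s i ^+ 2.
Proof.
move=> s0.
(* Pairing with the indicator of the support of [s] yields the number of nonzero [s i] in place of
   [n]. *)
pose e : 'cV[C]_n := \col_i (s i != 0)%:R.
have := CauchySchwarz_col (\col_i s i) e.
have -> : (e ^t* *m \col_i s i) 0 0 = \sum_i s i.
  rewrite mxE; apply: eq_bigr => i _; rewrite !mxE conjC_nat.
  by have [->|_] := eqVneq (s i) 0; rewrite ?mulr0 ?mul1r.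
rewrite !gramE ger0_norm ?sumr_ge0 //.
have -> : \sum_j `|e j 0| ^+ 2 = #|[set i | s i != 0]|%:R.
  rewrite -sum1_card natr_sum [RHS]big_mkcond /=; apply: eq_bigr => i _.
  by rewrite mxE inE; case: ifP => _; rewrite ?normr1 ?expr1n ?normr0 ?expr0n.
have -> : \sum_j `|(\col_i s i) j 0| ^+ 2 = \sum_i s i ^+ 2.
  by apply: eq_bigr => i _; rewrite mxE ger0_norm.
have q0 : 0 <= \sum_i s i ^+ 2 by rewrite sumr_ge0 // => i _; rewrite exprn_ge0.
rewrite -sqrtCM ?nnegrE ?ler0n // => le.
by rewrite -[leRHS]sqrtCK lerXn2r ?nnegrE ?sqrtC_ge0 ?(mulr_ge0, ler0n, q0) ?sumr_ge0.
Qed.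

(** * Bloch vectors and the correlation matrix as a linear map *)

Lemma mxtrace_tens m n (A : 'M[C]_m) (B : 'M[C]_n) : \tr (A ⊗ B) = \tr A * \tr B.
Proof.
rewrite /mxtrace mulr_sum; apply: eq_bigr => i _.
by rewrite mxE.
Qed.

(** For the Hilbert-Schmidt product the basis is orthogonal with squared norms [d], so each trace is
    [d] times a coordinate of [M]. *)
Lemma local_basis_parseval d (lam : 'I_(d ^ 2).-1.+1 -> 'M[C]_d) (M : 'M[C]_d) :
  local_basis lam ->
  \sum_i `|\tr (M *m (lam i) ^t*)| ^+ 2 = d%:R * \tr (M *m M ^t*).
Proof.
case=> hb _ ho.
have [c ->] : exists c, M = \sum_i c i *: lam i.
  pose X := [tuple lam i | i < (d ^ 2).-1.+1].
  have hX : basis_of {: 'M[C]_d} X.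
    by rewrite (_ : val X = [seq lam i | i <- enum 'I_(d ^ 2).-1.+1]).
  exists (coord X ^~ M); rewrite {1}(coord_basis hX (memvf M)).
  by apply: eq_bigr => i _; rewrite (nth_map i) ?size_enum_ord // nth_ord_enum.
have trE j : \tr ((\sum_i c i *: lam i) *m (lam j) ^t*) = d%:R * c j.
  rewrite mulmx_suml raddf_sum (bigD1 j) //= big1 => [|i ij].
    by rewrite -scalemxAl mxtraceZ ho eqxx mulr1 addr0 mulrC.
  by rewrite -scalemxAl mxtraceZ ho (negbTE ij) !mulr0.
under eq_bigr do rewrite trE.
rewrite [X in _ = _ * \tr (_ *m X)](_ : _ = \sum_i (c i)^* *: (lam i) ^t*); last first.
  rewrite [X in map_mx _ X]raddf_sum [LHS]raddf_sum; apply: eq_bigr => i _.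
  by apply/matrixP => a b; rewrite !mxE; apply: rmorphM.
rewrite mulmx_sumr raddf_sum mulr_sumr; apply: eq_bigr => i _ /=.
rewrite -scalemxAr mxtraceZ trE normrM exprMn normr_nat normCK expr2 -!mulrA.
by congr (_ * _); rewrite mulrA mulrC.
Qed.

Definition bloch_vector d (lam : 'I_(d ^ 2).-1.+1 -> 'M[C]_d) (M : 'M[C]_d) :
  'cV[C]_(d ^ 2).-1 := \col_i \tr (M *m (lam (lift ord0 i)) ^t*).

(** This is Parseval without the term of index 0, which is the trace of [M] because [lam ord0] is
    the identity. *)
Lemma bloch_vector_norm d (lam : 'I_(d ^ 2).-1.+1 -> 'M[C]_d) (M : 'M[C]_d) :
  local_basis lam ->
  \sum_i `|bloch_vector lam M i 0| ^+ 2 =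
    d%:R * \tr (M *m M ^t*) - `|\tr M| ^+ 2.
Proof.
move=> hlam; have [_ h0 _] := hlam.
rewrite -(local_basis_parseval _ hlam) big_ord_recl h0 trmx1 map_mx1.
rewrite mulmx1 addrAC subrr add0r.
by apply: eq_bigr => i _; rewrite mxE.
Qed.

(** Defined on all matrices, so that linearity also covers the non-Hermitian cross terms of an
    expanded pure state. *)
Definition corr_mx d1 d2 (lam1 : 'I_(d1 ^ 2).-1.+1 -> 'M[C]_d1)
  (lam2 : 'I_(d2 ^ 2).-1.+1 -> 'M[C]_d2) (rho : 'M[C]_(d1 * d2)) :
  'M[C]_((d1 ^ 2).-1, (d2 ^ 2).-1) :=
  \matrix_(i, j)
    \tr (rho *m ((lam1 (lift ord0 i)) ^t* ⊗ (lam2 (lift ord0 j)) ^t*)).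

Lemma corr_mx_tens d1 d2 (lam1 : 'I_(d1 ^ 2).-1.+1 -> 'M[C]_d1)
  (lam2 : 'I_(d2 ^ 2).-1.+1 -> 'M[C]_d2) (A : 'M[C]_d1) (B : 'M[C]_d2) :
  corr_mx lam1 lam2 (A ⊗ B) = bloch_vector lam1 A *m (bloch_vector lam2 B)^T.
Proof.
apply/matrixP => i j; rewrite !mxE big_ord1 !mxE.
by rewrite tensmx_mul mxtrace_tens.
Qed.

Lemma corr_mx_sum d1 d2 (lam1 : 'I_(d1 ^ 2).-1.+1 -> 'M[C]_d1)
  (lam2 : 'I_(d2 ^ 2).-1.+1 -> 'M[C]_d2) n (c : 'I_n -> C)
  (M : 'I_n -> 'M[C]_(d1 * d2)) :
  corr_mx lam1 lam2 (\sum_i c i *: M i) = \sum_i c i *: corr_mx lam1 lam2 (M i).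
Proof.
apply/matrixP => i j; rewrite mxE mulmx_suml raddf_sum summxE.
by apply: eq_bigr => k _; rewrite /= -scalemxAl mxtraceZ !mxE.
Qed.

(** Pairing the Bloch decomposition with one product basis element leaves only [T i j] by
    orthogonality; its factor [d1 * d2], nonzero by positivity, cancels the normalization. *)
Lemma correlation_matrixE d1 d2 (lam1 : 'I_(d1 ^ 2).-1.+1 -> 'M[C]_d1)
  (lam2 : 'I_(d2 ^ 2).-1.+1 -> 'M[C]_d2) (rho : 'M[C]_(d1 * d2)) T :
  (0 < d1)%N -> (0 < d2)%N -> local_basis lam1 -> local_basis lam2 ->
  correlation_matrix lam1 lam2 rho T -> T = corr_mx lam1 lam2 rho.
Proof.
move=> d1p d2p [_ h1 o1] [_ h2 o2] [al [be ->]].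
(* The identity is the basis element of index 0, so orthogonality makes the other elements
   traceless. *)
have tr1 i : \tr (1%:M *m (lam1 (lift ord0 i)) ^t*) = 0.
  by rewrite -h1 o1 mulr0.
have tr2 i : \tr (1%:M *m (lam2 (lift ord0 i)) ^t*) = 0.
  by rewrite -h2 o2 mulr0.
apply/matrixP => i j; rewrite mxE -scalemxAl mxtraceZ !mulmxDl !mxtraceD.
rewrite tensmx_mul mxtrace_tens tr1 mul0r add0r.
rewrite mulmx_suml raddf_sum big1 => [|a _]; last first.
  by rewrite /= -scalemxAl mxtraceZ tensmx_mul mxtrace_tens tr2 !mulr0.
rewrite mulmx_suml raddf_sum big1 => [|a _]; last first.
  by rewrite /= -scalemxAl mxtraceZ tensmx_mul mxtrace_tens tr1 mul0r mulr0.
rewrite !add0r mulmx_suml raddf_sum (bigD1 i) //= [X in _ + X]big1 => [|a ai]; last first.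
  rewrite mulmx_suml raddf_sum big1 // => b _ /=.
  rewrite -scalemxAl mxtraceZ tensmx_mul mxtrace_tens o1.
  by rewrite (inj_eq lift_inj) (negbTE ai) mulr0 mul0r mulr0.
rewrite addr0 mulmx_suml raddf_sum (bigD1 j) //= [X in _ + X]big1 => [|b bj]; last first.
  rewrite -scalemxAl mxtraceZ tensmx_mul mxtrace_tens o2.
  by rewrite (inj_eq lift_inj) (negbTE bj) !mulr0.
rewrite addr0 -scalemxAl mxtraceZ tensmx_mul mxtrace_tens o1 o2 !eqxx !mulr1.
by rewrite mulrCA mulVf ?mulr1 // mulf_neq0 // pnatr_eq0 -lt0n.
Qed.

(** * Product kets, Schmidt decompositions and the bound for pure states *)

Lemma trmxC_tens m n p q (A : 'M[C]_(m, n)) (B : 'M[C]_(p, q)) :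
  (A ⊗ B) ^t* = A ^t* ⊗ B ^t*.
Proof. by rewrite trmx_tens map_mxT. Qed.

Lemma inner_tensket d1 d2 (u u' : 'cV[C]_d1) (v v' : 'cV[C]_d2) :
  ((tensket u v) ^t* *m tensket u' v') 0 0 =
    (u ^t* *m u') 0 0 * (v ^t* *m v') 0 0.
Proof.
have -> : (tensket u v) ^t* *m tensket u' v' = (u ^t* *m u') ⊗ (v ^t* *m v').
  by rewrite -tensmx_mul -trmxC_tens.
by rewrite mxE; congr (_ * _); congr (fun_of_matrix _ _ _); apply: ord1.
Qed.

Lemma outer_tensket d1 d2 (u u' : 'cV[C]_d1) (v v' : 'cV[C]_d2) :
  tensket u v *m (tensket u' v') ^t* = (u *m u' ^t*) ⊗ (v *m v' ^t*).
Proof. by rewrite -tensmx_mul -trmxC_tens. Qed.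

Lemma trmxC_sum_scale m n (s : 'I_n -> C) (w : 'I_n -> 'cV[C]_m) :
  (forall i, 0 <= s i) ->
  (\sum_i s i *: w i) ^t* = \sum_i s i *: (w i) ^t*.
Proof.
move=> s0; rewrite [X in map_mx _ X]raddf_sum [LHS]raddf_sum.
apply: eq_bigr => i _; apply/matrixP => a b; rewrite !mxE [LHS]rmorphM.
by congr (_ * _); apply: conj_Creal; rewrite ger0_real.
Qed.

Lemma sum_sqr_schmidt d1 d2 (psi : 'cV[C]_(d1 * d2)) s u v :
  unit_ket psi -> schmidt_decomposition psi s u v -> \sum_i s i ^+ 2 = 1.
Proof.
rewrite /unit_ket => hu [ou ov s0 psiE]; move: hu; rewrite psiE trmxC_sum_scale // => <-.
rewrite mulmx_suml summxE; apply: eq_bigr => i _.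
rewrite mulmx_sumr summxE (bigD1 i) //= big1 => [|j ji].
  by rewrite addr0 -scalemxAl -scalemxAr 2!mxE inner_tensket ou ov eqxx !mulr1.
rewrite -scalemxAl -scalemxAr 2!mxE inner_tensket ou.
by rewrite eq_sym (negbTE ji) mul0r !mulr0.
Qed.

(** The matrix [u a *m (u b) ^t*] has Hilbert-Schmidt norm 1 and trace [(a == b)%:R]. *)
Lemma bloch_vector_outer_norm d n (lam : 'I_(d ^ 2).-1.+1 -> 'M[C]_d)
  (u : 'I_n -> 'cV[C]_d) a b :
  local_basis lam -> orthonormal_kets u ->
  \sum_i `|bloch_vector lam (u a *m (u b) ^t*) i 0| ^+ 2 = d%:R - (a == b)%:R.
Proof.
move=> hlam ou; rewrite bloch_vector_norm //.
rewrite trmxC_mul trmxCK mulmxA mxtrace_mulC [\tr (u a *m _)]mxtrace_mulC !mulmxA.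
rewrite -mulmxA /mxtrace !big_ord1 mxE big_ord1 !ou !eqxx !mulr1 eq_sym.
by rewrite normr_nat -natrX; case: (a == b).
Qed.

(** Stated for any contraction [W], so that the one attaining the norm for a mixture serves all its
    pure components. *)
Lemma pure_state_bound d1 d2 (lam1 : 'I_(d1 ^ 2).-1.+1 -> 'M[C]_d1)
  (lam2 : 'I_(d2 ^ 2).-1.+1 -> 'M[C]_d2) (W : 'M[C]_((d2 ^ 2).-1, (d1 ^ 2).-1))
  (psi : 'cV[C]_(d1 * d2)) q :
  (0 < d1)%N -> (0 < d2)%N -> local_basis lam1 -> local_basis lam2 ->
  contraction W -> unit_ket psi -> schmidt_rank psi q ->
  `|\tr (W *m corr_mx lam1 lam2 (ketbra psi))| <=
    sqrtC ((d1%:R - 1) * (d2%:R - 1)) + sqrtC (d1%:R * d2%:R) * (q%:R - 1).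
Proof.
move=> d1p d2p hl1 hl2 hW hpsi [s [u [v [hs <-]]]].
have [ou ov s0 psiE] := hs; have s1 := sum_sqr_schmidt hpsi hs.
have sub_ge0 d (b : bool) : (0 < d)%N -> (0 : C) <= d%:R - b%:R.
  by move=> dp; rewrite subr_ge0 ler_nat; apply: leq_trans (leq_b1 _) dp.
set r1 := sqrtC ((_ - _) * _); set r0 := sqrtC (_ * _).
(* The bound is [r1] on the diagonal and [r0] off it; this single formula lets the double sum split
   into [(\sum_a s a) ^+ 2] and [\sum_a s a ^+ 2]. *)
have le_ab a b : `|\tr (W *m corr_mx lam1 lam2
    ((u a *m (u b) ^t*) ⊗ (v a *m (v b) ^t*)))| <= r0 + (a == b)%:R * (r1 - r0).
  rewrite corr_mx_tens; apply: le_trans (contraction_rank1 _ _ hW) _.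
  rewrite !bloch_vector_outer_norm // -sqrtCM ?nnegrE ?sub_ge0 // /r1 /r0.
  by case: (a == b) => /=; rewrite ?subr0 ?mul0r ?addr0 // mul1r addrCA subrr addr0.
have -> : ketbra psi = \sum_a s a *: \sum_b s b *:
    ((u a *m (u b) ^t*) ⊗ (v a *m (v b) ^t*)).
  rewrite /ketbra psiE trmxC_sum_scale // mulmx_suml; apply: eq_bigr => a _.
  rewrite -scalemxAl mulmx_sumr; congr (_ *: _); apply: eq_bigr => b _.
  by rewrite -scalemxAr outer_tensket.
rewrite corr_mx_sum mulmx_sumr raddf_sum.
have le_sum : `|\sum_a \tr (W *m (s a *: corr_mx lam1 lam2 (\sum_b s b *:
    ((u a *m (u b) ^t*) ⊗ (v a *m (v b) ^t*)))))| <=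
  \sum_a \sum_b s a * s b * (r0 + (a == b)%:R * (r1 - r0)).
  apply: le_trans (ler_norm_sum _ _ _) _; apply: ler_sum => a _.
  rewrite -scalemxAr mxtraceZ normrM (ger0_norm (s0 a)) corr_mx_sum.
  under [leRHS]eq_bigr do rewrite -mulrA.
  rewrite -mulr_sumr ler_wpM2l // mulmx_sumr raddf_sum.
  apply: le_trans (ler_norm_sum _ _ _) _; apply: ler_sum => b _.
  by rewrite /= -scalemxAr mxtraceZ normrM (ger0_norm (s0 b)) ler_wpM2l.
apply: le_trans le_sum _.
have -> : \sum_a \sum_b s a * s b * (r0 + (a == b)%:R * (r1 - r0)) =
    (\sum_a s a) ^+ 2 * r0 + (\sum_a s a ^+ 2) * (r1 - r0).
  rewrite [X in X * r0]expr2 mulr_suml !mulr_suml -big_split.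
  apply: eq_bigr => a _ /=.
  under eq_bigr do rewrite mulrDr.
  rewrite big_split /= mulr_sumr mulr_suml; congr (_ + _).
  rewrite (bigD1 a) //= big1 ?addr0 ?eqxx ?mul1r // => b ba.
  by rewrite eq_sym (negbTE ba) mul0r mulr0.
have r0p : 0 <= r0 by rewrite sqrtC_ge0 mulr_ge0.
(* Both sides contain [r1 - r0]; what remains is that [(\sum_a s a) ^+ 2] is at most the Schmidt
   rank. *)
rewrite s1 mul1r mulrBr mulr1 addrCA lerD2l lerD2r mulrC ler_wpM2l //.
by rewrite (le_trans (sqr_sum_le_card s0)) // s1 mulr1.
Qed.

End NumClosed.

Unset Implicit Arguments.
Set Strict Implicit.

(** * Passage from pure states to mixtures *)

Theorem lemma1 (R : realType) (d1 d2 : nat)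
  (hd1 : (0 < d1)%N) (hd12 : (d1 <= d2)%N)
  (lam1 : 'I_(d1 ^ 2).-1.+1 -> 'M[R[i]]_d1)
  (lam2 : 'I_(d2 ^ 2).-1.+1 -> 'M[R[i]]_d2)
  (hlam1 : local_basis lam1) (hlam2 : local_basis lam2)
  (rho : 'M[R[i]]_(d1 * d2)) (hrho : density_matrix rho)
  (T : 'M[R[i]]_((d1 ^ 2).-1, (d2 ^ 2).-1))
  (hT : correlation_matrix lam1 lam2 rho T)
  (k : nat) (hk : (1 <= k)%N)
  (sn : nat) (hsn : schmidt_number rho sn) (hsnk : (sn <= k)%N) :
  trace_norm T <=
    sqrtC ((d1%:R - 1) * (d2%:R - 1)) + sqrtC (d1%:R * d2%:R) * (k%:R - 1).
Proof.
have hd2 := leq_trans hd1 hd12.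
have [[n [p [psi [p0 p1 hpsi hrank rhoE]]]] _] := hsn.
have TE := correlation_matrixE hd1 hd2 hlam1 hlam2 hT.
have [W hW TW] := trace_norm_dual T.
rewrite -(ger0_norm (trace_norm_ge0 T)) TW TE rhoE corr_mx_sum mulmx_sumr raddf_sum.
apply: le_trans (ler_norm_sum _ _ _) _.
(* As the [p i] sum to 1, the bound is its own average, and the comparison is made term by term. *)
set bound := leRHS; rewrite -[bound]mul1r -p1 mulr_suml; apply: ler_sum => i _.
rewrite /= -scalemxAr mxtraceZ normrM (ger0_norm (p0 i)) ler_wpM2l //.
have [q hq qsn] := hrank i.
apply: le_trans (pure_state_bound hd1 hd2 hlam1 hlam2 hW (hpsi i) hq) _.
rewrite /bound lerD2l ler_wpM2l ?sqrtC_ge0 ?mulr_ge0 ?ler0n // lerD2r ler_nat.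
exact: leq_trans qsn hsnk.
Qed.
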